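(* Let $1<p\le2$ and assume $\sup_{\xi\in\mathcal{I}}\|v_\xi\|_{L^\infty(\overline{M})}/\|u_\xi\|_{L^\infty(\overline{M})}<\infty$. Let $\varphi$ be a positive function on $\mathcal{I}$ such that $$M_\varphi:=\sup_{t>0}\,t\sum_{\xi\in\mathcal{I}:\ t\le\varphi(\xi)}\|u_\xi\|^2_{L^\infty(\overline{M})}<\infty.$$ Then for every $f\in L^p(\overline{M})$, $$\Big(\sum_{\xi\in\mathcal{I}}|\mathcal{F}_Lf(\xi)|^p\,\|u_\xi\|_{L^\infty(\overline{M})}^{2-p}\,\varphi(\xi)^{2-p}\Big)^{1/p}\lesssim M_\varphi^{\frac{2-p}{p}}\|f\|_{L^p(\overline{M})}.$$
   Context: Standing setup: $\overline{M}$ is a smooth orientable manifold with (possibly empty) boundary and a smooth density $dx$. $L$ is a pseudo-differential operator on its interior with boundary conditions giving discrete spectrum $\{\lambda_\xi\}_{\xi\in\mathcal{I}}$ ($\mathcal{I}$ countable), eigenfunctions $u_\xi$ of $L$ and $v_\xi$ of $L^*$ ($L^*v_\xi=\overline{\lambda_\xi}v_\xi$), with $\|u_\xi\|_{L^2}=\|v_\xi\|_{L^2}=1$, $(u_\xi,v_\eta)_{L^2}=\delta_{\xi\eta}$, $\{u_\xi\}$ a Riesz basis of $L^2(\overline{M})$, and $u_\xi,v_\xi\in L^\infty(\overline{M})$. $\mathcal{F}_Lf(\xi):=\int_{\overline{M}}f(x)\overline{v_\xi(x)}\,dx$. *)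

(* Defs.v *)
From HB Require Import structures.
From mathcomp Require Import all_boot all_order all_algebra.
From mathcomp Require Import all_classical all_reals all_analysis ess_sup_inf hoelder.
From mathcomp.real_closed Require Import complex.

Set Implicit Arguments.
Unset Strict Implicit.
Unset Printing Implicit Defensive.

Import Order.TTheory GRing.Theory Num.Theory.
Import numFieldNormedType.Exports.

Local Open Scope classical_set_scope.
Local Open Scope ring_scope.

Section Defs.
Context {d : measure_display} {T : measurableType d} {R : realType}.
Variable mu : {measure set T -> \bar R}.

Definition cnorm (z : R[i]) : R := Normc.normc z.

Definition cmeasurable (f : T -> R[i]) : Prop :=
  measurable_fun setT (fun x => complex.Re (f x)) /\ measurable_fun setT (fun x => complex.Im (f x)).

Definition cabs (f : T -> R[i]) : T -> \bar R := fun x => (cnorm (f x))%:E.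

Definition Lp_norm (p : R) (f : T -> R[i]) : \bar R := Lnorm mu p%:E (cabs f).

Definition Linf_norm (f : T -> R[i]) : \bar R := ess_sup mu (cabs f).

Definition in_Lp (p : R) (f : T -> R[i]) : Prop :=
  cmeasurable f /\ (Lp_norm p f < +oo)%E.

Definition in_Linf (f : T -> R[i]) : Prop :=
  cmeasurable f /\ (Linf_norm f < +oo)%E.

Definition cintegral (f : T -> R[i]) : R[i] := Complex
  (Rintegral mu setT (fun x => complex.Re (f x))) (Rintegral mu setT (fun x => complex.Im (f x))).

Definition inner (f g : T -> R[i]) : R[i] := cintegral (fun x => f x * conjc (g x)).

Variable I : countType.

Definition FL (v : I -> T -> R[i]) (f : T -> R[i]) (xi : I) : R[i] :=
  cintegral (fun x => f x * conjc (v xi x)).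

Definition lincomb (u : I -> T -> R[i]) (s : seq I) (c : I -> R[i]) : T -> R[i] :=
  fun x => \sum_(xi <- s) c xi * u xi x.

(* {u_xi} is a Riesz basis of L^2: a complete Riesz sequence. *)
Definition riesz_basis (u : I -> T -> R[i]) : Prop :=
  (forall xi, in_Lp 2 (u xi)) /\
  (exists A B : R, 0 < A /\ 0 < B /\
     forall (s : seq I) (c : I -> R[i]), uniq s ->
       ((A * \sum_(xi <- s) cnorm (c xi) ^+ 2)%:E
          <= \int[mu]_x (cnorm (lincomb u s c x) ^+ 2)%:E)%E /\
       (\int[mu]_x (cnorm (lincomb u s c x) ^+ 2)%:E
          <= (B * \sum_(xi <- s) cnorm (c xi) ^+ 2)%:E)%E) /\
  (forall f, in_Lp 2 f -> forall eps : R, 0 < eps ->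
     exists (s : seq I) (c : I -> R[i]),
       (Lp_norm 2 (fun x => (f x - lincomb u s c x)%R) < eps%:E)%E).

Definition Mphi (u : I -> T -> R[i]) (phi : I -> R) : \bar R :=
  ereal_sup [set (t%:E * \esum_(xi in [set xi | (t <= phi xi)%R])
                         ((fine (Linf_norm (u xi))) ^+ 2)%:E)%E
            | t in [set t : R | 0 < t]].

End Defs.

(* Main.v *)
Require Import Defs.
From HB Require Import structures.
From mathcomp Require Import all_boot all_order all_algebra.
From mathcomp Require Import all_classical all_reals all_analysis ess_sup_inf hoelder.
From mathcomp Require Import measurable_realfun finmap ring lra.
From mathcomp.real_closed Require Import complex.

(* For p = 2 the claim is Bessel's inequality for (F_L f), which the lower Riesz
   bound and the completeness of (u_xi) give by approximation with finite linear
   combinations.  For 1 < p < 2, replacing phi by phi / M reduces to M = 1, and it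
   suffices to bound sums over a finite set of indices.  Put
   G = |F_L f| / (||u|| phi) and weigh xi by ||u||^2 phi^2.  On the indices with
   y < G <= 2 y, split f at height y: either the high part, estimated by
   |F_L g| <= 2 ||v||_oo ||g||_1, forces phi <= C ||f 1_{|f| > y}||_1 / y, a set of
   weight at most 4 C ||f 1_{|f| > y}||_1 / y by the hypothesis on phi; or the low
   part carries half of F_L f and Bessel applies to it.  Summing over the dyadic
   levels y = delta 2^k under the integral sign, the two geometric series
   \sum_{y < |f|} y^(p-1) and \sum_{y >= |f|} y^(p-2) both give |f|^p.  All sums
   over k are finite because only finitely many xi are considered. *)

Import Order.TTheory GRing.Theory Num.Theory.
Local Open Scope classical_set_scope.
Local Open Scope ring_scope.

(** * Dyadic decompositions *)

Lemma powR_double (R : realType) (x r : R) : 0 <= x -> (2 * x) `^ r = 2 `^ r * x `^ r.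
Proof. by move=> x0; rewrite powRM. Qed.

Lemma powR2_gt1 (R : realType) (r : R) : 0 < r -> 1 < 2 `^ r.
Proof.
move=> r0; have : (1 : R) `^ r < 2 `^ r by apply: gt0_ltr_powR; rewrite ?nnegrE//; lra.
by rewrite powR1.
Qed.

(** The intervals [(y, 2 * y]] with [y = delta * 2 ^+ k] and [k < n] tile
    [(delta, delta * 2 ^+ n]]. *)
Lemma dyadic_level {R : realType} {delta g : R} {n : nat} :
  delta < g -> g <= delta * 2 ^+ n ->
  exists2 k, (k < n)%N & delta * 2 ^+ k < g <= 2 * (delta * 2 ^+ k).
Proof.
move=> dg; elim: n => [|n IHn] gn; first by lra.
have [/IHn[k kn kP]|gn'] := leP g (delta * 2 ^+ n).
  by exists k => //; exact: ltnW.
by exists n => //; rewrite gn' (le_trans gn)// exprS; lra.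
Qed.

Lemma dyadic_cofinal {R : realType} {delta b : R} : 0 < delta -> 0 < b ->
  exists n, b <= delta * 2 ^+ n.
Proof.
move=> d0 b0; exists (Num.bound (b / delta)); rewrite -ler_pdivrMl// mulrC.
have : b / delta < (Num.bound (b / delta))%:R by rewrite archi_boundP// divr_ge0// ltW.
move=> /ltW/le_trans; apply; rewrite -natrX ler_nat ltnW//; exact: ltn_expl.
Qed.

(** A finite list has finitely many positive values, so finitely many dyadic levels meet all of
    them; this keeps every later sum over levels finite. *)
Lemma dyadic_range {R : realType} {I : eqType} (s : seq I) (g : I -> R) :
  exists delta : R, exists n : nat, 0 < delta /\
    forall i, i \in s -> 0 < g i -> delta < g i /\ g i <= delta * 2 ^+ n.
Proof.
suff [delta [b [d0 b0 H]]] : exists delta b : R,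
    [/\ 0 < delta, 0 < b & forall i, i \in s -> 0 < g i -> delta < g i /\ g i <= b].
  have [n bn] := dyadic_cofinal d0 b0.
  exists delta, n; split => // i /H{}H /H[gi1 gi2]; split => //.
  exact: le_trans bn.
elim: s => [|j s [delta [b [d0 b0 H]]]]; first by exists 1, 1; split.
have [gj|gj] := leP (g j) 0.
  exists delta, b; split => // i; rewrite inE => /predU1P[->|]; last exact: H.
  by rewrite ltNge gj.
(* Halving [g j] makes the lower bound strict, as the left-open levels require. *)
exists (Num.min delta (g j / 2)), (Num.max b (g j)); split.
- by rewrite lt_min d0/= divr_gt0.
- by rewrite lt_max b0.
- move=> i; rewrite inE => /predU1P[->|si gi].
    by rewrite gt_min le_max lexx orbT; split=> //; apply/orP; right; lra.
  by have [h1 h2] := H _ si gi; rewrite gt_min h1 le_max h2.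
Qed.

(** Telescoping replaces the geometric series: with [m k] the height [y k] truncated at [2 * t],
    each term with [y k < t], multiplied by [q - 1], equals the increment of [m k]^
    alpha[. The total increment is at most](2 * t) [^ alpha]. *)
Lemma dyadic_sum_below {R : realType} (delta t alpha : R) n : 0 < delta -> 0 < t -> 0 < alpha ->
  \sum_(k < n | delta * 2 ^+ k < t) (delta * 2 ^+ k) `^ alpha
    <= 2 `^ alpha / (2 `^ alpha - 1) * t `^ alpha.
Proof.
move=> d0 t0 a0; set q := 2 `^ alpha.
have q1 : 1 < q by exact: powR2_gt1.
pose y k := delta * 2 ^+ k.
have y0 k : 0 < y k by rewrite mulr_gt0// exprn_gt0.
have yS k : y k.+1 = 2 * y k by rewrite /y exprS; ring.
pose m k := Num.min (y k) (2 * t).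
have m0 k : 0 <= m k by rewrite le_min !ltW//; lra.
have -> : q / (q - 1) * t `^ alpha = (2 * t) `^ alpha / (q - 1).
  by rewrite powR_double ?ltW// mulrAC.
rewrite ler_pdivlMr ?subr_gt0//.
suff H : (\sum_(k < n | y k < t) (y k) `^ alpha) * (q - 1) <= m n `^ alpha - m 0%N `^ alpha.
  apply: (le_trans H); rewrite lerBlDr (@le_trans _ _ ((2 * t) `^ alpha))//.
    by apply: ge0_ler_powR; rewrite ?nnegrE ?(ltW a0)// ?mulr_ge0 ?(ltW t0)// ge_min lexx orbT.
  by rewrite lerDl powR_ge0.
elim: n => [|n IHn]; first by rewrite big_ord0 mul0r subrr.
rewrite big_mkcond big_ord_recr/= -big_mkcond/= mulrDl.
rewrite -[leRHS](subrKA (m n `^ alpha)) addrC lerD//.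
case: ifPn => [yt|_]; last first.
  rewrite mul0r subr_ge0; apply: ge0_ler_powR; rewrite ?nnegrE ?(ltW a0)//.
  by rewrite /m le_min !ge_min lexx orbT andbT yS; apply/orP; left; have := y0 n; lra.
have -> : m n.+1 = 2 * y n by rewrite /m yS; apply/min_idPl; rewrite ler_pM2l// ltW.
have -> : m n = y n by rewrite /m; apply/min_idPl; lra.
by rewrite powR_double ?(ltW (y0 n))// -/q; lra.
Qed.

Lemma dyadic_sum_above {R : realType} (delta t beta : R) n : 0 < delta -> 0 < t -> 0 < beta ->
  \sum_(k < n | t <= delta * 2 ^+ k) (delta * 2 ^+ k) `^ (- beta)
    <= (1 - 2 `^ (- beta))^-1 * t `^ (- beta).
Proof.
move=> d0 t0 b0; set q := 2 `^ (- beta).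
have q1 : q < 1 by rewrite /q powRN invf_lt1 ?powR_gt0// powR2_gt1.
pose y k := delta * 2 ^+ k.
have y0 k : 0 < y k by rewrite mulr_gt0// exprn_gt0.
have yS k : y k.+1 = 2 * y k by rewrite /y exprS; ring.
pose m k := Num.max (y k) t.
have m0 k : 0 < m k by rewrite lt_max t0 orbT.
have anti a b : 0 < a -> a <= b -> b `^ (- beta) <= a `^ (- beta).
  move=> a0 ab; have bb0 := lt_le_trans a0 ab.
  rewrite !powRN lef_pV2 ?posrE ?powR_gt0//.
  by apply: ge0_ler_powR; rewrite ?nnegrE ?(ltW b0) ?(ltW a0) ?(ltW bb0).
rewrite mulrC ler_pdivlMr ?subr_gt0//.
suff H : (\sum_(k < n | t <= y k) (y k) `^ (- beta)) * (1 - q)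
     <= m 0%N `^ (- beta) - m n `^ (- beta).
  apply: (le_trans H); rewrite lerBlDr (@le_trans _ _ (t `^ (- beta)))//.
    by apply: anti => //; rewrite le_max lexx orbT.
  by rewrite lerDl powR_ge0.
elim: n => [|n IHn]; first by rewrite big_ord0 mul0r subrr.
rewrite big_mkcond big_ord_recr/= -big_mkcond/= mulrDl.
rewrite -[leRHS](subrKA (m n `^ (- beta))) lerD//.
case: ifPn => [yt|_]; last first.
  rewrite mul0r subr_ge0; apply: anti => //.
  by rewrite /m ge_max !le_max lexx orbT andbT yS; apply/orP; left; have := y0 n; lra.
have -> : m n.+1 = 2 * y n by rewrite /m yS; apply/max_idPl; have := y0 n; lra.
have -> : m n = y n by rewrite /m; apply/max_idPl.
by rewrite powR_double ?(ltW (y0 n))// -/q; lra.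
Qed.

(* The hypothesis controls the shell [w / 2 < phi <= w]; halving [w] repeatedly exhausts [s]. *)
Lemma sum_below_level {R : realType} {I : eqType} (s : seq I) (a phi : I -> R) (w : R) :
  (forall i, 0 < phi i) ->
  (forall t, 0 < t -> t * \sum_(i <- s | t <= phi i) a i ^+ 2 <= 1) ->
  0 <= w -> \sum_(i <- s | phi i <= w) a i ^+ 2 * phi i ^+ 2 <= 4 * w.
Proof.
move=> phi0 H; rewrite le_eqVlt => /predU1P[<-|w0].
  by rewrite mulr0 big1// => i; rewrite leNgt phi0.
have [delta [n [d0 dP]]] := dyadic_range s phi.
have [J wJ] := dyadic_cofinal d0 w0.
(* Induction on the number of halvings that bring [w] down to [delta]; in the base case
   [w <= delta < phi i] leaves no index. *)
elim: J w w0 wJ => [|J IHJ] w w0 wJ.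
  rewrite big_seq_cond big1 ?mulr_ge0 ?ltW// => i /andP[si]; rewrite leNgt => /negP[].
  have [di _] := dP _ si (phi0 i).
  by rewrite (le_lt_trans wJ)// expr0 mulr1.
have w2 : 0 < w / 2 by rewrite divr_gt0.
have {}IHJ := IHJ _ w2.
have /IHJ{}IHJ : w / 2 <= delta * 2 ^+ J by move: wJ; rewrite exprS; lra.
rewrite (bigID (fun i => phi i <= w / 2))/=.
have -> : \sum_(i <- s | (phi i <= w) && (phi i <= w / 2)) a i ^+ 2 * phi i ^+ 2 =
    \sum_(i <- s | phi i <= w / 2) a i ^+ 2 * phi i ^+ 2.
  apply: eq_bigl => i; rewrite andbC; apply/andb_idr => ?; lra.
have shell : \sum_(i <- s | (phi i <= w) && ~~ (phi i <= w / 2)) a i ^+ 2 * phi i ^+ 2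
    <= w ^+ 2 * \sum_(i <- s | w / 2 <= phi i) a i ^+ 2.
  rewrite mulr_sumr big_mkcond [leRHS]big_mkcond/= ler_sum// => i _.
  case: ifPn => [/andP[iw]|_]; last first.
    by case: ifPn => // _; rewrite mulr_ge0// sqr_ge0.
  rewrite -ltNge => /ltW ->; rewrite mulrC ler_wpM2r ?sqr_ge0//.
  by rewrite ler_sqr ?nnegrE ?(ltW w0) ?(ltW (phi0 i)).
(* The hypothesis at [t = w / 2] gives [S <= 2 / w], so the shell weighs at most [2 * w]; the
   indices below [w / 2] weigh at most [4 * (w / 2)], and the total is [4 * w]. *)
have := H _ w2; set S := \sum_(i <- s | w / 2 <= phi i) a i ^+ 2 in shell * => HS.
have : w ^+ 2 * S <= 2 * w.
  by have := ler_wpM2l (ltW w0) HS; rewrite expr2 => ?; lra.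
by move=> ?; lra.
Qed.

(* At a point where [F = g * (a * phi)] with [y < g <= 2 * y], either the L^1 part
   accounts for half of [F] and [phi <= 2 * K * N1 / y], or the L^2 part does and
   [a * phi <= 2 * F2 / y]. *)
Lemma weak_level_bound {R : realType} (F F2 a phi K N1 y p : R) :
  0 < a -> 0 < phi -> 0 < y -> 1 < p <= 2 -> 0 <= F2 ->
  F <= K * a * N1 + F2 -> y < F / (a * phi) <= 2 * y ->
  F `^ p * a `^ (2 - p) * phi `^ (2 - p) <=
    4 * y `^ p * ((if phi <= 2 * K * N1 / y then a ^+ 2 * phi ^+ 2 else 0)
                    + 4 * F2 ^+ 2 / y ^+ 2).
Proof.
move=> a0 phi0 y0 /andP[p1 p2] F20 HF /andP[yg gy].
have aphi : 0 < a * phi by rewrite mulr_gt0.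
set g := F / (a * phi) in yg gy.
have FE : F = g * (a * phi) by rewrite /g divfK// gt_eqF.
have g0 : 0 < g by exact: lt_trans yg.
(* The powers [p] and [2 - p] of [a * phi] combine to its square, the weight of the index. *)
have -> : F `^ p * a `^ (2 - p) * phi `^ (2 - p) = g `^ p * (a ^+ 2 * phi ^+ 2).
  rewrite FE powRM ?ltW// -!mulrA; congr (_ * _).
  rewrite -powRM ?ltW// -powRD; last by rewrite (gt_eqF aphi) implybT.
  by rewrite addrC subrK powR_mulrn ?(ltW aphi)// exprMn expr2 -mulrA.
have gp : g `^ p <= 4 * y `^ p.
  apply: (@le_trans _ _ ((2 * y) `^ p)).
    by apply: ge0_ler_powR => //; rewrite ?nnegrE; lra.
  rewrite powR_double ?(ltW y0)// ler_wpM2r ?powR_ge0//.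
  have -> : 4 = 2 `^ 2 :> R by rewrite powR_mulrn//; ring.
  by apply: ler_powR => //; lra.
apply: (le_trans (ler_wpM2r _ gp)); first by rewrite mulr_ge0 ?sqr_ge0.
rewrite ler_wpM2l ?mulr_ge0 ?powR_ge0//.
have F2y : 0 <= 4 * F2 ^+ 2 / y ^+ 2 by rewrite divr_ge0 ?sqr_ge0 ?mulr_ge0 ?sqr_ge0.
case: ifPn => [_|]; first by rewrite lerDl.
(* Beyond the threshold, [K * a * N1] is less than half of [y * (a * phi)], while [F] exceeds
   [y * (a * phi)]; hence [F2] carries the other half. *)
rewrite -ltNge add0r ltr_pdivrMr// => HN.
have Fy : y * (a * phi) < F by rewrite FE ltr_pM2r.
have : y * (a * phi) <= 2 * F2.
  have := ltr_pM2l a0 (2 * K * N1) (phi * y); rewrite HN => h; lra.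
move=> h; rewrite ler_pdivlMr ?exprn_gt0//.
have : (y * (a * phi)) ^+ 2 <= (2 * F2) ^+ 2.
  by rewrite ler_sqr ?nnegrE// mulr_ge0// ltW.
by rewrite !exprMn; lra.
Qed.

(** The interpolation step stripped of integrals. It is applied with [F] the size of the transform
    of [f], [N1 y] the L^1 norm of the part of [f] above [y], [N2 y] the squared L^2 norm of the
    part below, and [F2 y] the size of the transform of the latter. Each index is charged to the
    level containing its quotient; exchanging the sums, [sum_below_level] bounds the first
    alternative and [B] the second. *)
Lemma weak_level_sum {R : realType} {I : eqType} (s : seq I) (a phi F : I -> R) (p K B : R)
    (N1 N2 : R -> R) (F2 : R -> I -> R) (delta : R) (n : nat) :
  (forall i, 0 < a i) -> (forall i, 0 < phi i) -> 1 < p <= 2 -> 0 <= K -> 0 < delta ->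
  (forall t, 0 < t -> t * \sum_(i <- s | t <= phi i) a i ^+ 2 <= 1) ->
  (forall y, 0 < y -> 0 <= N1 y) ->
  (forall y i, 0 <= F2 y i) ->
  (forall i, 0 <= F i) ->
  (forall y i, 0 < y -> F i <= K * a i * N1 y + F2 y i) ->
  (forall y, 0 < y -> \sum_(i <- s) F2 y i ^+ 2 <= B * N2 y) ->
  (forall i, i \in s -> 0 < F i / (a i * phi i) ->
    delta < F i / (a i * phi i) /\ F i / (a i * phi i) <= delta * 2 ^+ n) ->
  \sum_(i <- s) F i `^ p * a i `^ (2 - p) * phi i `^ (2 - p) <=
    \sum_(k < n) (32 * K * ((delta * 2 ^+ k) `^ (p - 1) * N1 (delta * 2 ^+ k))
        + 16 * B * ((delta * 2 ^+ k) `^ (p - 2) * N2 (delta * 2 ^+ k))).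
Proof.
move=> a0 phi0 hp K0 d0 HM N10 F20 F0 HF HB Hrange.
have /andP[p1 p2] := hp.
pose y k := delta * 2 ^+ k.
have y0 k : 0 < y k by rewrite mulr_gt0// exprn_gt0.
pose w k i := 4 * y k `^ p *
  ((if phi i <= 2 * K * N1 (y k) / y k then a i ^+ 2 * phi i ^+ 2 else 0)
                    + 4 * F2 (y k) i ^+ 2 / y k ^+ 2).
have w0 k i : 0 <= w k i.
  rewrite mulr_ge0 ?mulr_ge0 ?powR_ge0// addr_ge0//.
    by case: ifP => // _; rewrite mulr_ge0 ?sqr_ge0.
  by rewrite divr_ge0 ?sqr_ge0 ?mulr_ge0 ?sqr_ge0.
apply: (@le_trans _ _ (\sum_(i <- s) \sum_(k < n) w k i)).
  rewrite big_seq [leRHS]big_seq; apply: ler_sum => i si.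
  have aphi : 0 < a i * phi i by rewrite mulr_gt0.
  (* Indices that no level contains have [F i = 0], and contribute nothing because [p] is
     positive. *)
  have [g0|g0] := leP (F i / (a i * phi i)) 0.
    have -> : F i = 0.
      apply/eqP; rewrite eq_le F0 andbT.
      by move: g0; rewrite ler_pdivrMr// mul0r.
    by rewrite powR0 ?gt_eqF ?(lt_trans _ p1)// !mul0r sumr_ge0.
  have [dg gn] := Hrange _ si g0.
  have [k kn yg] := dyadic_level dg gn.
  rewrite (bigD1 (Ordinal kn))//= -[leLHS]addr0 lerD ?sumr_ge0//.
  by apply: (@weak_level_bound _ _ (F2 (y k) i) _ _ K (N1 (y k)) (y k)) => //; exact: HF.
rewrite exchange_big/=; apply: ler_sum => k _; rewrite -/(y k).
rewrite -mulr_sumr big_split/= -big_mkcond/=.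
have h1 : \sum_(i <- s | phi i <= 2 * K * N1 (y k) / y k) a i ^+ 2 * phi i ^+ 2
    <= 4 * (2 * K * N1 (y k) / y k).
  apply: sum_below_level => //.
  by rewrite divr_ge0 ?(ltW (y0 k))// mulr_ge0 ?N10// mulr_ge0.
have h2 : \sum_(i <- s) 4 * F2 (y k) i ^+ 2 / y k ^+ 2 <= 4 * (B * N2 (y k)) / y k ^+ 2.
  by rewrite -mulr_suml -mulr_sumr ler_pM2r ?invr_gt0 ?exprn_gt0// ler_pM2l// HB.
(* The constants are [32 = 4 * 4 * 2] from [h1] and [16 = 4 * 4] from [h2]. *)
apply: (le_trans (ler_wpM2l _ (lerD h1 h2))); first by rewrite mulr_ge0 ?powR_ge0.
have yneq : y k != 0 by rewrite gt_eqF.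
have -> : y k `^ (p - 1) = y k `^ p / y k.
  by rewrite powRB ?yneq ?implybT// powRr1 ?(ltW (y0 k)).
have -> : y k `^ (p - 2) = y k `^ p / y k ^+ 2.
  by rewrite powRB ?yneq ?implybT// powR_mulrn ?(ltW (y0 k)).
rewrite le_eqVlt; apply/orP; left; apply/eqP; field; exact: yneq.
Qed.

(** * Complex-valued integrals *)

Section Cnorm.
Context {R : realType}.
Implicit Types z w : R[i].

Lemma cnorm_ge0 z : 0 <= cnorm z.
Proof. by case: z => a b; exact: sqrtr_ge0. Qed.

Lemma cnormM z w : cnorm (z * w) = cnorm z * cnorm w.
Proof. exact: Normc.normcM. Qed.

Lemma cnormD z w : cnorm (z + w) <= cnorm z + cnorm w.
Proof. exact: le_normcD. Qed.

Lemma cnorm0 : cnorm (0 : R[i]) = 0.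
Proof. exact: Normc.normc0. Qed.

Lemma cnorm_conj z : cnorm (conjc z) = cnorm z.
Proof. by case: z => a b; rewrite /cnorm /= sqrrN. Qed.

Lemma norm_Re_le z : `|complex.Re z| <= cnorm z.
Proof. by case: z => a b; rewrite /cnorm /= -sqrtr_sqr ler_wsqrtr// lerDl sqr_ge0. Qed.

Lemma norm_Im_le z : `|complex.Im z| <= cnorm z.
Proof. by case: z => a b; rewrite /cnorm /= -sqrtr_sqr ler_wsqrtr// lerDr sqr_ge0. Qed.

Lemma cnorm_le_ReIm z : cnorm z <= `|complex.Re z| + `|complex.Im z|.
Proof.
case: z => a b; rewrite /cnorm /= -[leRHS]ger0_norm ?addr_ge0// -sqrtr_sqr.
rewrite ler_wsqrtr// sqrrD !real_normK ?num_real// lerD2r lerDl.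
by rewrite mulrn_wge0// mulr_ge0.
Qed.

Lemma cnormE z : cnorm z = Num.sqrt (complex.Re z ^+ 2 + complex.Im z ^+ 2).
Proof. by case: z. Qed.

Lemma cnormD_sqr z w : cnorm (z + w) ^+ 2 <= 2 * cnorm z ^+ 2 + 2 * cnorm w ^+ 2.
Proof.
have h : cnorm (z + w) ^+ 2 <= (cnorm z + cnorm w) ^+ 2.
  by rewrite ler_sqr ?nnegrE ?addr_ge0 ?cnorm_ge0// cnormD.
by have := sqr_ge0 (cnorm z - cnorm w); rewrite sqrrB => ?; move: h; rewrite sqrrD; lra.
Qed.

End Cnorm.

Section ComplexIntegral.
Context {d : measure_display} {T : measurableType d} {R : realType}.
Variable mu : {measure set T -> \bar R}.
Implicit Types f g : T -> R[i].

Definition cintegrable f :=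
  mu.-integrable setT (EFin \o (fun x => complex.Re (f x))) /\
  mu.-integrable setT (EFin \o (fun x => complex.Im (f x))).

Lemma cmeasurable_cnorm f : cmeasurable f -> measurable_fun setT (fun x => cnorm (f x)).
Proof.
move=> [mr mi].
under eq_fun => x do rewrite cnormE -powR12_sqrt ?addr_ge0 ?sqr_ge0//.
apply: (measurableT_comp (measurable_powR _)).
by apply: measurable_funD; apply: measurable_funX.
Qed.

Lemma cmeasurableD f g : cmeasurable f -> cmeasurable g -> cmeasurable (fun x => f x + g x).
Proof.
move=> [fr fi] [gr gi]; split.
  rewrite [X in measurable_fun _ X](_ : _ = fun x => complex.Re (f x) + complex.Re (g x)).
    exact: measurable_funD.
  by apply/funext => x; case: (f x); case: (g x).
rewrite [X in measurable_fun _ X](_ : _ = fun x => complex.Im (f x) + complex.Im (g x)).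
  exact: measurable_funD.
by apply/funext => x; case: (f x); case: (g x).
Qed.

Lemma cmeasurableM f g : cmeasurable f -> cmeasurable g -> cmeasurable (fun x => f x * g x).
Proof.
move=> [fr fi] [gr gi]; split.
  rewrite [X in measurable_fun _ X](_ : _ = fun x =>
     complex.Re (f x) * complex.Re (g x) - complex.Im (f x) * complex.Im (g x)).
    by apply: measurable_funB; apply: measurable_funM.
  by apply/funext => x; case: (f x); case: (g x).
rewrite [X in measurable_fun _ X](_ : _ = fun x =>
     complex.Re (f x) * complex.Im (g x) + complex.Im (f x) * complex.Re (g x)).
  by apply: measurable_funD; apply: measurable_funM.
by apply/funext => x; case: (f x); case: (g x).
Qed.

Lemma cmeasurable_conj f : cmeasurable f -> cmeasurable (fun x => conjc (f x)).
Proof.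
move=> [fr fi]; split.
  by rewrite [X in measurable_fun _ X](_ : _ = fun x => complex.Re (f x));
    last by apply/funext => x; case: (f x).
rewrite [X in measurable_fun _ X](_ : _ = fun x => - complex.Im (f x)).
  exact: measurableT_comp.
by apply/funext => x; case: (f x).
Qed.

Lemma cmeasurable_cst (c : R[i]) : cmeasurable (fun _ : T => c).
Proof. by split; exact: measurable_cst. Qed.

Lemma cmeasurable_if (b : T -> bool) f : measurable_fun setT b -> cmeasurable f ->
  cmeasurable (fun x => if b x then f x else 0).
Proof.
move=> mb [fr fi]; split.
  rewrite [X in measurable_fun _ X](_ : _ = fun x => if b x then complex.Re (f x) else 0).
    by apply: measurable_fun_ifT => //; exact: measurable_cst.
  by apply/funext => x; case: (b x).
rewrite [X in measurable_fun _ X](_ : _ = fun x => if b x then complex.Im (f x) else 0).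
  by apply: measurable_fun_ifT => //; exact: measurable_cst.
by apply/funext => x; case: (b x).
Qed.

Lemma integrable_ae_le (h g : T -> R) : measurable_fun setT h ->
  mu.-integrable setT (EFin \o g) -> (forall x, 0 <= g x) ->
  {ae mu, forall x, `|h x| <= g x} ->
  mu.-integrable setT (EFin \o h) /\ `|\int[mu]_x h x| <= \int[mu]_x g x.
Proof.
move=> mh ig g0 hg; have /integrableP[mg ig'] := ig.
have le : (\int[mu]_x `|(EFin \o h) x| <= \int[mu]_x (EFin \o g) x)%E.
  apply: ae_ge0_le_integral => //.
  - by apply: measurableT_comp => //; exact/measurable_EFinP.
  - by move=> x _; rewrite lee_fin.
  - by apply: filterS hg => x hx _; rewrite /= lee_fin.
have ih : mu.-integrable setT (EFin \o h).
  apply/integrableP; split; first exact/measurable_EFinP.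
  by apply: (le_lt_trans le); exact: integrable_lty.
split => //; apply: (le_trans (le_normr_Rintegral measurableT ih)).
rewrite /Rintegral; apply: fine_le => //.
- apply: integrable_fin_num => //.
  by have := integrable_abse ih; apply: eq_integrable => // x _.
- exact: integrable_fin_num.
Qed.

(** The factor 2 comes from bounding the real and imaginary parts separately; it only affects the
    final constant. *)
Lemma cintegral_ae_le f (g : T -> R) : cmeasurable f ->
  mu.-integrable setT (EFin \o g) -> (forall x, 0 <= g x) ->
  {ae mu, forall x, cnorm (f x) <= g x} ->
  cintegrable f /\ cnorm (cintegral mu f) <= 2 * \int[mu]_x g x.
Proof.
move=> [fr fi] ig g0 fg.
have [ir br] := integrable_ae_le _ _ fr ig g0
  (filterS (fun x => le_trans (norm_Re_le (f x))) fg).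
have [ii bi] := integrable_ae_le _ _ fi ig g0
  (filterS (fun x => le_trans (norm_Im_le (f x))) fg).
split; first by split.
apply: (le_trans (cnorm_le_ReIm _)); rewrite /=.
by apply: (le_trans (lerD br bi)); lra.
Qed.

Lemma cintegralD f g : cintegrable f -> cintegrable g ->
  cintegral mu (fun x => f x + g x) = cintegral mu f + cintegral mu g.
Proof.
move=> [fr fi] [gr gi]; rewrite /cintegral.
rewrite [LHS](_ : _ = Complex (\int[mu]_x (complex.Re (f x) + complex.Re (g x)))
                       (\int[mu]_x (complex.Im (f x) + complex.Im (g x)))).
  by rewrite !RintegralD.
by congr Complex; apply: eq_Rintegral => x _; case: (f x); case: (g x).
Qed.

Lemma cintegrableD f g : cintegrable f -> cintegrable g ->
  cintegrable (fun x => f x + g x).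
Proof.
move=> [fr fi] [gr gi]; split.
  have := integrableD measurableT fr gr; apply: eq_integrable => // x _ /=.
  by rewrite -EFinD; case: (f x); case: (g x).
have := integrableD measurableT fi gi; apply: eq_integrable => // x _ /=.
by rewrite -EFinD; case: (f x); case: (g x).
Qed.

Lemma integrableZ_EFin (k : R) (h : T -> R) : mu.-integrable setT (EFin \o h) ->
  mu.-integrable setT (EFin \o (fun x => k * h x)).
Proof. by move=> ih; have := integrableZl measurableT k ih; exact: eq_integrable. Qed.

Lemma cintegrableZ (c : R[i]) f : cintegrable f -> cintegrable (fun x => c * f x) /\
  cintegral mu (fun x => c * f x) = c * cintegral mu f.
Proof.
move=> [fr fi]; case: c => a b.
split.
  split.
    have := integrableB measurableT (integrableZ_EFin a _ fr) (integrableZ_EFin b _ fi).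
    apply: eq_integrable => // x _ /=.
    by rewrite -EFinB; case: (f x).
  have := integrableD measurableT (integrableZ_EFin a _ fi) (integrableZ_EFin b _ fr).
  apply: eq_integrable => // x _ /=.
  by rewrite -EFinD; case: (f x).
rewrite /cintegral.
rewrite [LHS](_ : _ = Complex
   (\int[mu]_x (a * complex.Re (f x) - b * complex.Im (f x)))
   (\int[mu]_x (a * complex.Im (f x) + b * complex.Re (f x)))).
  rewrite RintegralB ?RintegralD//; [|exact: integrableZ_EFin..].
  by rewrite !RintegralZl.
by congr Complex; apply: eq_Rintegral => x _; case: (f x).
Qed.

Lemma cintegral0 : cintegrable (fun _ => 0) /\ cintegral mu (fun _ => 0) = 0.
Proof.
split; first by split; exact: integrable0.
by rewrite /cintegral /Rintegral !integral0.
Qed.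

Lemma cintegral_lincomb (I : countType) (u : I -> T -> R[i]) s c :
  (forall xi, cintegrable (u xi)) ->
  cintegrable (lincomb u s c) /\
  cintegral mu (lincomb u s c) = \sum_(xi <- s) c xi * cintegral mu (u xi).
Proof.
move=> iu; rewrite /lincomb; elim: s => [|i s [IHi IHe]].
  rewrite big_nil (_ : (fun x : T => _) = fun _ => 0); first exact: cintegral0.
  by apply/funext => x; rewrite big_nil.
have -> : (fun x => \sum_(xi <- i :: s) c xi * u xi x) =
   (fun x => c i * u i x + \sum_(xi <- s) c xi * u xi x).
  by apply/funext => x; rewrite big_cons.
have [h1 h2] := cintegrableZ (c i) _ (iu i).
by split; [exact: cintegrableD | rewrite cintegralD// big_cons IHe h2].
Qed.

Lemma integrable_lincomb (k l : R) (g h : T -> R) :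
  mu.-integrable setT (EFin \o g) -> mu.-integrable setT (EFin \o h) ->
  mu.-integrable setT (EFin \o (fun x => k * g x + l * h x)) /\
  \int[mu]_x (k * g x + l * h x) = k * (\int[mu]_x g x) + l * \int[mu]_x h x.
Proof.
move=> ig ih; split.
  have := integrableD measurableT (integrableZ_EFin k _ ig) (integrableZ_EFin l _ ih).
  exact: eq_integrable.
by rewrite RintegralD ?RintegralZl//; exact: integrableZ_EFin.
Qed.

(** Membership in L^2 through a natural-number power and a real-valued integral; [in_L2_sqint] and
    [sqint_in_L2] translate from and to [in_Lp mu 2]. *)
Definition sqint f := cmeasurable f /\ mu.-integrable setT (EFin \o (fun x => cnorm (f x) ^+ 2)).

(* Cauchy--Schwarz up to a constant: optimising [t] recovers the product of the norms. *)
Lemma inner_sqint f g (t : R) : sqint f -> sqint g -> 0 < t ->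
  cintegrable (fun x => f x * conjc (g x)) /\
  cnorm (inner mu f g) <=
    t * (\int[mu]_x (cnorm (f x) ^+ 2)) + t^-1 * \int[mu]_x (cnorm (g x) ^+ 2).
Proof.
move=> [mf f2] [mg g2] t0.
have t'0 : 0 < t^-1 by rewrite invr_gt0.
(* The halves cancel the factor 2 of [cintegral_ae_le]; the pointwise bound is the weighted
   inequality between arithmetic and geometric means. *)
have [ii eq] := integrable_lincomb (t / 2) (t^-1 / 2) _ _ f2 g2.
have := @cintegral_ae_le (fun x => f x * conjc (g x))
   (fun x => t / 2 * cnorm (f x) ^+ 2 + t^-1 / 2 * cnorm (g x) ^+ 2).
case=> //.
- by apply: cmeasurableM => //; exact: cmeasurable_conj.
- by move=> x; rewrite addr_ge0// mulr_ge0 ?sqr_ge0// ltW// divr_gt0.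
- apply: aeW => x; rewrite cnormM cnorm_conj.
  have := sqr_ge0 (cnorm (f x) - t^-1 * cnorm (g x)).
  set a := cnorm _; set b := cnorm _ => h.
  have : 0 <= t / 2 * (a - t^-1 * b) ^+ 2 by rewrite mulr_ge0// divr_ge0// ltW.
  have -> : t / 2 * (a - t^-1 * b) ^+ 2 = t / 2 * a ^+ 2 + t^-1 / 2 * b ^+ 2 - a * b.
    by field; rewrite gt_eqF.
  by rewrite subr_ge0.
- by move=> ic h; split => //; move: h; rewrite eq; rewrite /inner => h; lra.
Qed.

Lemma sqintD f g : sqint f -> sqint g -> sqint (fun x => f x + g x) /\
  \int[mu]_x (cnorm (f x + g x) ^+ 2) <=
    2 * (\int[mu]_x (cnorm (f x) ^+ 2)) + 2 * \int[mu]_x (cnorm (g x) ^+ 2).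
Proof.
move=> [mf f2] [mg g2]; have mfg := cmeasurableD _ _ mf mg.
have [ii eq] := integrable_lincomb 2 2 _ _ f2 g2.
have [] := @integrable_ae_le (fun x => cnorm (f x + g x) ^+ 2) _ _ ii.
- by apply: measurable_funX; exact: cmeasurable_cnorm.
- by move=> x; rewrite addr_ge0// mulr_ge0// sqr_ge0.
- by apply: aeW => x; rewrite ger0_norm ?sqr_ge0// cnormD_sqr.
- move=> ih; rewrite eq => h; split => //.
  by apply: le_trans h; exact: ler_norm.
Qed.

Lemma sqintZ (c : R[i]) f : sqint f -> sqint (fun x => c * f x).
Proof.
move=> [mf f2]; split; first by apply: cmeasurableM => //; exact: cmeasurable_cst.
have := integrableZl measurableT (cnorm c ^+ 2) f2; apply: eq_integrable => // x _ /=.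
by rewrite cnormM exprMn.
Qed.

Lemma sqint0 : sqint (fun=> 0).
Proof.
split; first exact: cmeasurable_cst.
have := integrable0 mu (setT : set T); apply: eq_integrable => // x _.
by rewrite [RHS]/comp cnorm0 expr0n.
Qed.

Lemma sqint_lincomb (I : countType) (u : I -> T -> R[i]) s c :
  (forall xi, sqint (u xi)) -> sqint (lincomb u s c).
Proof.
move=> iu; rewrite /lincomb; elim: s => [|i s IHi].
  rewrite (_ : (fun x : T => _) = fun _ => 0); first exact: sqint0.
  by apply/funext => x; rewrite big_nil.
have -> : (fun x => \sum_(xi <- i :: s) c xi * u xi x) =
   (fun x => c i * u i x + \sum_(xi <- s) c xi * u xi x).
  by apply/funext => x; rewrite big_cons.
by have [] := sqintD _ _ (sqintZ (c i) _ (iu i)) IHi.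
Qed.

(** Passes from the extended-real norm to a real integral, so that the estimates can be carried out
    in [R]. *)
Lemma in_Lp_integrable p f : 0 < p -> in_Lp mu p f ->
  mu.-integrable setT (EFin \o (fun x => cnorm (f x) `^ p)) /\
  Lp_norm mu p f = ((\int[mu]_x (cnorm (f x) `^ p)) `^ p^-1)%:E.
Proof.
move=> p0 [mf]; have := poweR_Lnorm mu (cabs f) (lt0r_neq0 p0).
rewrite -/(Lp_norm _ _ _); set N := Lp_norm mu p f => eN Nfin.
have N0 : (0 <= N)%E by exact: Lnorm_ge0.
have {}eN : (N `^ p = \int[mu]_x (cnorm (f x) `^ p)%:E)%E.
  rewrite eN; apply: eq_integral => x _.
  by rewrite /cabs abse_EFin ger0_norm ?cnorm_ge0.
have Ii : mu.-integrable setT (EFin \o (fun x => cnorm (f x) `^ p)).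
  apply/integrableP; split.
    apply/measurable_EFinP; apply: (measurableT_comp (measurable_powR _)).
    exact: cmeasurable_cnorm.
  rewrite (eq_integral (fun x => (cnorm (f x) `^ p)%:E)).
    by rewrite -eN poweR_lty.
  by move=> x _ /=; rewrite ger0_norm ?powR_ge0.
split => //.
have Nf : N \is a fin_num by rewrite ge0_fin_numE.
rewrite /Rintegral -eN fine_poweR -powRrM mulfV ?gt_eqF// powRr1 ?fine_ge0//.
by rewrite fineK.
Qed.

Lemma in_L2_sqint f : in_Lp mu 2 f -> sqint f /\
  Lp_norm mu 2 f = (Num.sqrt (\int[mu]_x (cnorm (f x) ^+ 2)))%:E.
Proof.
move=> f2; have mf := f2.1.
have [i2 e2] := in_Lp_integrable 2 f (ltac:(lra)) f2.
have E : (fun x => cnorm (f x) `^ 2) = (fun x => cnorm (f x) ^+ 2).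
  by apply/funext => x; rewrite powR_mulrn ?cnorm_ge0.
rewrite E in i2 e2; split; first by split.
by rewrite e2 powR12_sqrt// Rintegral_ge0// => x _; rewrite sqr_ge0.
Qed.

Lemma sqint_in_L2 f : sqint f -> in_Lp mu 2 f.
Proof.
move=> [mf f2]; split => //; rewrite /Lp_norm unlock.
apply: poweR_lty; rewrite (eq_integral (EFin \o (fun x => cnorm (f x) ^+ 2))).
  exact: integrable_lty.
by move=> x _ /=; rewrite ger0_norm ?cnorm_ge0// powR_mulrn// cnorm_ge0.
Qed.

End ComplexIntegral.

(** * Bessel's inequality *)

Lemma sum_mul_delta {C : pzRingType} {I : eqType} (t : seq I) (i : I) (F : I -> C) :
  uniq t -> i \in t -> \sum_(j <- t) (i == j)%:R * F j = F i.
Proof.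
move=> ut it; rewrite (bigD1_seq i)//= eqxx mul1r big1 ?addr0// => j.
by rewrite eq_sym => /negPf ->; rewrite mul0r.
Qed.

Section Bessel.
Context {d : measure_display} {T : measurableType d} {R : realType}.
Variable mu : {measure set T -> \bar R}.

(** By biorthogonality the transform of a finite combination [h] of the [u xi] is its family of
    coefficients, which the lower Riesz bound [A] controls. Completeness approximates [g] by such an
    [h]; the constant [4 / A] comes from using [cnormD_sqr] twice. *)
Lemma riesz_bessel (I : countType) (u v : I -> T -> R[i]) :
  riesz_basis mu u ->
  (forall xi, in_Lp mu 2 (v xi) /\ Lp_norm mu 2 (v xi) = 1%E) ->
  (forall xi eta, inner mu (u xi) (v eta) = (xi == eta)%:R) ->
  exists2 B : R, 0 < B & forall g, sqint mu g -> forall s : seq I, uniq s ->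
    \sum_(xi <- s) cnorm (FL mu v g xi) ^+ 2 <= B * \int[mu]_x (cnorm (g x) ^+ 2).
Proof.
move=> [uL2 [[A [A' [A0 [_ hA]]]] ucomplete]] vL2 biorth.
exists (4 / A) => [|g gi X uX]; first by rewrite divr_gt0.
have usq xi : sqint mu (u xi) by have [] := in_L2_sqint mu _ (uL2 xi).
have vsq xi : sqint mu (v xi) by have [] := in_L2_sqint mu _ (vL2 xi).1.
have v1 xi : \int[mu]_x (cnorm (v xi x) ^+ 2) = 1.
  have [_] := in_L2_sqint mu _ (vL2 xi).1; rewrite (vL2 xi).2 => -[] h.
  rewrite -[LHS]sqr_sqrtr; first by rewrite -h expr1n.
  by apply: Rintegral_ge0 => x _; rewrite sqr_ge0.
set G := \int[mu]_x _; set S := \sum_(xi <- X) _.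
(* Here [e] bounds the squared L^2 error of the approximation. Each index costs [8 * e], which is
   harmless since [X] is fixed before [e] tends to 0. *)
have key e : 0 < e -> S <= 4 / A * G + e * (4 / A + 8 * (size X)%:R).
  move=> e0; set eps := Num.sqrt e.
  have eps0 : 0 < eps by rewrite sqrtr_gt0.
  have epsE : eps ^+ 2 = e by rewrite sqr_sqrtr// ltW.
  have [s [c hsc]] := ucomplete _ (sqint_in_L2 mu _ gi) eps eps0.
  set h := lincomb u s c in hsc.
  have hsq : sqint mu h by exact: sqint_lincomb.
  pose r x := g x - h x.
  have rsq : sqint mu r.
    have [+ _] := sqintD mu _ _ gi (sqintZ mu (-1) _ hsq).
    by rewrite (_ : (fun x => _) = r)//; apply/funext => x; rewrite mulN1r.
  have rint : \int[mu]_x (cnorm (r x) ^+ 2) <= e.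
    have [_ rE] := in_L2_sqint mu _ (sqint_in_L2 mu _ rsq).
    move: hsc; rewrite -/(r) rE lte_fin => /ltW.
    rewrite ler_psqrt ?nnegrE ?(ltW e0)//.
    by apply: Rintegral_ge0 => x _; rewrite sqr_ge0.
  have hint : \int[mu]_x (cnorm (h x) ^+ 2) <= 2 * G + 2 * e.
    have [_] := sqintD mu _ _ gi (sqintZ mu (-1) _ rsq).
    rewrite (_ : (fun x => cnorm (g x + -1 * r x) ^+ 2) = (fun x => cnorm (h x) ^+ 2)); last first.
      by apply/funext => x; rewrite mulN1r /r opprB addrC subrK.
    rewrite (_ : (fun x => cnorm (-1 * r x) ^+ 2) = (fun x => cnorm (r x) ^+ 2)); last first.
      apply/funext => x; rewrite cnormM (_ : cnorm (-1) = 1) ?mul1r//.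
      by rewrite /cnorm normcN Normc.normc1.
    by move=> /le_trans; apply; rewrite lerD2l ler_pM2l.
  (* The list [s] may have repetitions; [c'] adds up the coefficients of equal indices. *)
  pose c' xi := \sum_(i <- s) c i * (i == xi)%:R.
  have Fh xi : inner mu h (v xi) = c' xi.
    have iu eta : cintegrable mu (fun x => u eta x * conjc (v xi x)).
      by have [] := inner_sqint mu _ _ 1 (usq eta) (vsq xi) ltr01.
    transitivity (\sum_(i <- s) c i * inner mu (u i) (v xi)); last first.
      by apply: eq_bigr => i _; rewrite biorth.
    rewrite -(cintegral_lincomb mu _ (fun eta x => u eta x * conjc (v xi x)) s c iu).2.
    congr cintegral; apply/funext => x; rewrite /h /lincomb mulr_suml.
    by apply: eq_bigr => i _; rewrite mulrA.
  (* A duplicate-free list containing both [X] and [s]: the Riesz bound applies to it, and the sum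
     over [X] is part of the sum over [t]. *)
  pose t := X ++ [seq i <- undup s | i \notin X].
  have ut : uniq t.
    rewrite cat_uniq uX filter_uniq ?undup_uniq// andbT/=.
    by apply/hasPn => i; rewrite mem_filter => /andP[].
  have ht : h = lincomb u t c'.
    apply/funext => x; rewrite /h /lincomb.
    under [RHS]eq_bigr do rewrite mulr_suml.
    rewrite exchange_big/= big_seq [RHS]big_seq; apply: eq_bigr => i si.
    under eq_bigr do rewrite -mulrA.
    rewrite -mulr_sumr; congr (_ * _); rewrite (sum_mul_delta t i (fun j => u j x))//.
    by rewrite mem_cat mem_filter mem_undup si andbT orbN.
  have cX : \sum_(xi <- X) cnorm (c' xi) ^+ 2 <= A^-1 * (2 * G + 2 * e).
    apply: (@le_trans _ _ (\sum_(xi <- t) cnorm (c' xi) ^+ 2)).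
      by rewrite big_cat/= lerDl sumr_ge0// => i _; rewrite sqr_ge0.
    rewrite ler_pdivlMl//; apply: le_trans hint.
    have [+ _] := hA t c' ut; rewrite -ht.
    have -> : (\int[mu]_x (cnorm (h x) ^+ 2)%:E)%E = (\int[mu]_x (cnorm (h x) ^+ 2))%:E.
      by rewrite /Rintegral fineK//; apply: integrable_fin_num => //; exact: hsq.2.
    by rewrite lee_fin.
  have Fg xi : cnorm (FL mu v g xi) ^+ 2 <= 2 * cnorm (c' xi) ^+ 2 + 8 * e.
    have [ih _] := inner_sqint mu _ _ 1 hsq (vsq xi) ltr01.
    (* With [r] of squared norm at most [eps ^+ 2] and [v xi] of norm 1, the weight [eps^-1]
       balances the two terms of [inner_sqint] at [eps] each. *)
    have eps'0 : 0 < eps^-1 by rewrite invr_gt0.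
    have [ir br] := inner_sqint mu _ _ (eps^-1) rsq (vsq xi) eps'0.
    have -> : FL mu v g xi = c' xi + inner mu r (v xi).
      rewrite -Fh /inner -cintegralD// /FL; congr cintegral; apply/funext => x.
      by rewrite -mulrDl /r addrC subrK.
    apply: (le_trans (cnormD_sqr _ _)); rewrite lerD2l.
    have {}br : cnorm (inner mu r (v xi)) <= 2 * eps.
      apply: (le_trans br); rewrite v1 invrK mulr1.
      have : eps^-1 * (\int[mu]_x (cnorm (r x) ^+ 2)) <= eps^-1 * e by rewrite ler_pM2l.
      have -> : eps^-1 * e = eps by rewrite -epsE expr2 mulKf// gt_eqF.
      lra.
    have : cnorm (inner mu r (v xi)) ^+ 2 <= (2 * eps) ^+ 2.
      by rewrite ler_sqr ?nnegrE ?cnorm_ge0// mulr_ge0// ltW.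
    by rewrite exprMn epsE; lra.
  have : S <= 2 * (\sum_(xi <- X) cnorm (c' xi) ^+ 2) + 8 * e * (size X)%:R.
    apply: (le_trans (ler_sum _ (fun xi _ => Fg xi))).
    by rewrite big_split/= -mulr_sumr big_const_seq count_predT iter_addr_0 mulr_natr.
  move/le_trans; apply.
  have -> : 4 / A * G + e * (4 / A + 8 * (size X)%:R) =
     2 * (A^-1 * (2 * G + 2 * e)) + 8 * e * (size X)%:R by ring.
  by rewrite lerD2r ler_pM2l.
apply/ler_addgt0Pr => e e0.
have D0 : 0 < 4 / A + 8 * (size X)%:R.
  by rewrite ltr_wpDr ?mulr_ge0 ?divr_gt0.
have := key (e / (4 / A + 8 * (size X)%:R)); rewrite divfK ?gt_eqF//; apply.
by rewrite divr_gt0.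
Qed.

Lemma Linf_norm_ae f : in_Linf mu f ->
  {ae mu, forall x, cnorm (f x) <= fine (Linf_norm mu f)}.
Proof.
move=> [_]; rewrite /Linf_norm => hf.
have := ess_sup_ge mu (cabs f); apply: filterS => x; rewrite /cabs.
by case: (ess_sup mu _) hf => [r||]//= _; rewrite ?lee_fin.
Qed.

(** A function with nonpositive essential supremum of its modulus vanishes almost everywhere,
    against the normalisation in L^2. This permits division by the sup norms of the [u xi]. *)
Lemma Linf_norm_gt0 f : in_Linf mu f -> in_Lp mu 2 f -> Lp_norm mu 2 f = 1%E ->
  0 < fine (Linf_norm mu f).
Proof.
move=> fI f2 f1; rewrite ltNge; apply/negP => le0.
have [sq] := in_L2_sqint mu _ f2; rewrite f1.
have [] := @integrable_ae_le _ _ _ mu (fun x => cnorm (f x) ^+ 2) (fun=> 0).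
- by apply: measurable_funX; apply: cmeasurable_cnorm; exact: sq.1.
- exact: integrable0.
- by [].
- have := Linf_norm_ae _ fI; apply: filterS => x h.
  have -> : cnorm (f x) = 0.
    by apply/eqP; rewrite eq_le cnorm_ge0 andbT (le_trans h).
  by rewrite expr0n normr0.
- move=> _; rewrite [X in _ <= X]/Rintegral integral0 normr_le0 => /eqP ->.
  by rewrite sqrtr0 => -[] /eqP; rewrite oner_eq0.
Qed.

(** Lets the series over the levels be estimated pointwise, under the integral sign. *)
Lemma sum_integral_le n (c : nat -> R) (h : nat -> T -> R) (g : T -> R) :
  (forall k, mu.-integrable setT (EFin \o h k)) ->
  mu.-integrable setT (EFin \o g) ->
  (forall x, \sum_(k < n) c k * h k x <= g x) ->
  \sum_(k < n) c k * (\int[mu]_x h k x) <= \int[mu]_x g x.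
Proof.
move=> ih ig hg.
have [isum se] : mu.-integrable setT (EFin \o (fun x => \sum_(k < n) c k * h k x)) /\
  \int[mu]_x (\sum_(k < n) c k * h k x) = \sum_(k < n) c k * (\int[mu]_x h k x).
  elim: n {hg} => [|n [IHi IHe]].
    rewrite big_ord0 (_ : (fun x => _) = fun=> 0).
      by split; [exact: integrable0 | rewrite /Rintegral integral0].
    by apply/funext => x; rewrite big_ord0.
  have [h1 h2] := integrable_lincomb mu 1 (c n) _ _ IHi (ih n).
  rewrite (_ : (fun x => _) =
      (fun x => 1 * (\sum_(k < n) c k * h k x) + c n * h n x)).
    by rewrite h2 mul1r IHe big_ord_recr.
  by apply/funext => x; rewrite big_ord_recr mul1r.
rewrite -se; apply: le_Rintegral => //.
Qed.

End Bessel.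

(** * Splitting at a height *)

Section Splitting.
Context {d : measure_display} {T : measurableType d} {R : realType}.
Variable mu : {measure set T -> \bar R}.
Variables (f : T -> R[i]) (p : R).
Hypotheses (mf : cmeasurable f) (p1 : 1 < p) (p2 : p < 2).
Hypothesis fp : mu.-integrable setT (EFin \o (fun x => cnorm (f x) `^ p)).

Definition high y x := if y < cnorm (f x) then f x else 0.
Definition low y x := if cnorm (f x) <= y then f x else 0.

Lemma cmeasurable_high y : cmeasurable (high y).
Proof.
apply: cmeasurable_if => //; apply: measurable_fun_ltr; first exact: measurable_cst.
exact: cmeasurable_cnorm.
Qed.

Lemma cmeasurable_low y : cmeasurable (low y).
Proof.
apply: cmeasurable_if => //; apply: measurable_fun_ler; last exact: measurable_cst.
exact: cmeasurable_cnorm.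
Qed.

Lemma high_add_low y x : high y x + low y x = f x.
Proof. by rewrite /high /low; case: ltP; rewrite ?addr0 ?add0r. Qed.

(** Where the modulus [t] of [f] exceeds [y], [p > 1] gives [t <= y]^ (1 - p) * t [^ p]. *)
Lemma integrable_high y : 0 < y -> mu.-integrable setT (EFin \o (fun x => cnorm (high y x))).
Proof.
move=> y0.
have ig := integrableZl measurableT (y `^ (1 - p)) fp.
apply: (le_integrable measurableT) ig.
  by apply/measurable_EFinP; apply: cmeasurable_cnorm; exact: cmeasurable_high.
move=> x _; rewrite /= lee_fin ger0_norm ?cnorm_ge0// ger0_norm ?mulr_ge0 ?powR_ge0//.
rewrite /high; case: ifPn => [yf|_]; last by rewrite cnorm0 mulr_ge0 ?powR_ge0.
have f0 := lt_trans y0 yf; set t := cnorm _ in yf f0 *.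
have -> : t `^ p = t `^ (p - 1) * t.
  by rewrite mulrC mulr_powRB1 ?(ltW f0)// (lt_trans _ p1).
have -> : 1 - p = - (p - 1) by rewrite opprB.
rewrite mulrA ler_peMl ?(ltW f0)// powRN mulrC ler_pdivlMr ?powR_gt0// mul1r.
by apply: ge0_ler_powR; rewrite ?nnegrE ?subr_ge0 ?(ltW p1) ?(ltW y0) ?(ltW f0) ?(ltW yf).
Qed.

(** Where the modulus [t] of [f] is at most [y], [p < 2] gives [t ^+ 2 <= y]^ (2 - p) * t [^ p]. *)
Lemma sqint_low y : 0 < y -> sqint mu (low y).
Proof.
move=> y0; split; first exact: cmeasurable_low.
have ig := integrableZl measurableT (y `^ (2 - p)) fp.
apply: (le_integrable measurableT) ig.
  apply/measurable_EFinP; apply: measurable_funX; apply: cmeasurable_cnorm.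
  exact: cmeasurable_low.
move=> x _; rewrite /= lee_fin ger0_norm ?sqr_ge0// ger0_norm ?mulr_ge0 ?powR_ge0//.
rewrite /low; case: ifPn => [yf|_]; last by rewrite cnorm0 expr0n mulr_ge0 ?powR_ge0.
have := cnorm_ge0 (f x); rewrite le_eqVlt => /predU1P[<-|].
  by rewrite expr0n mulr_ge0 ?powR_ge0.
set t := cnorm _ in yf * => f0.
have -> : t ^+ 2 = t `^ (2 - p) * t `^ p.
  by rewrite -powRD ?(gt_eqF f0) ?implybT// subrK powR_mulrn ?(ltW f0).
rewrite ler_wpM2r ?powR_ge0//.
by apply: ge0_ler_powR; rewrite ?nnegrE ?subr_ge0 ?(ltW p2) ?(ltW y0) ?(ltW f0).
Qed.

(** At a point [x] only the levels below [cnorm (f x)] contribute, so [dyadic_sum_below] with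
    exponent [p - 1] leaves one more factor [cnorm (f x)], in all its power [p]. *)
Lemma sum_high_le (delta : R) n : 0 < delta ->
  \sum_(k < n) (delta * 2 ^+ k) `^ (p - 1) *
     (\int[mu]_x cnorm (high (delta * 2 ^+ k) x)) <=
  2 `^ (p - 1) / (2 `^ (p - 1) - 1) * \int[mu]_x (cnorm (f x) `^ p).
Proof.
move=> d0; set q := _ / _.
have y0 k : 0 < delta * 2 ^+ k by rewrite mulr_gt0// exprn_gt0.
(* The second coefficient is 0: the lemma only moves the constant [q] inside the integral. *)
have [ig ge] := integrable_lincomb mu q 0 _ _ fp fp.
rewrite mul0r addr0 in ge; rewrite -ge.
apply: (sum_integral_le mu n (fun k => (delta * 2 ^+ k) `^ (p - 1))
   (fun k x => cnorm (high (delta * 2 ^+ k) x))) => // [k|x].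
  exact: integrable_high.
rewrite mul0r addr0.
have := cnorm_ge0 (f x); rewrite le_eqVlt => /predU1P[f0|f0].
  rewrite big1 => [|k _]; last first.
    by rewrite (_ : high _ x = 0) ?cnorm0 ?mulr0// /high -f0 ltNge (ltW (y0 k)).
  by rewrite mulr_ge0 ?powR_ge0// divr_ge0 ?powR_ge0// subr_ge0 ltW// powR2_gt1// subr_gt0.
have p10 : 0 < p - 1 by rewrite subr_gt0.
have := @dyadic_sum_below R delta _ (p - 1) n d0 f0 p10; rewrite -/q.
move=> /(ler_wpM2r (ltW f0)); rewrite -mulrA.
have -> : cnorm (f x) `^ (p - 1) * cnorm (f x) = cnorm (f x) `^ p.
  by rewrite mulrC mulr_powRB1 ?(ltW f0)// (lt_trans _ p1).
apply: le_trans; rewrite mulr_suml [leRHS]big_mkcond/=; apply: ler_sum => k _.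
by rewrite /high; case: ifP => //; rewrite cnorm0 mulr0.
Qed.

(** At a point [x] only the levels at or above [cnorm (f x)] contribute, so [dyadic_sum_above] with
    exponent [2 - p] leaves the factor [cnorm (f x) ^+ 2]. *)
Lemma sum_low_le (delta : R) n : 0 < delta ->
  \sum_(k < n) (delta * 2 ^+ k) `^ (p - 2) *
     (\int[mu]_x (cnorm (low (delta * 2 ^+ k) x) ^+ 2)) <=
  (1 - 2 `^ (- (2 - p)))^-1 * \int[mu]_x (cnorm (f x) `^ p).
Proof.
move=> d0; set q := _^-1.
have y0 k : 0 < delta * 2 ^+ k by rewrite mulr_gt0// exprn_gt0.
have [ig ge] := integrable_lincomb mu q 0 _ _ fp fp.
rewrite mul0r addr0 in ge; rewrite -ge.
have p20 : 0 < 2 - p by rewrite subr_gt0.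
apply: (sum_integral_le mu n (fun k => (delta * 2 ^+ k) `^ (p - 2))
   (fun k x => cnorm (low (delta * 2 ^+ k) x) ^+ 2)) => // [k|x].
  exact: (sqint_low _ (y0 k)).2.
rewrite mul0r addr0.
have := cnorm_ge0 (f x); rewrite le_eqVlt => /predU1P[f0|f0].
  rewrite big1 => [|k _]; last first.
    by rewrite /low -f0; case: ifP => _; rewrite -?f0 ?cnorm0 expr0n mulr0.
  rewrite mulr_ge0 ?powR_ge0// invr_ge0 subr_ge0 powRN invf_le1 ?powR_gt0//.
  by rewrite ltW// powR2_gt1.
have := @dyadic_sum_above R delta _ (2 - p) n d0 f0 p20; rewrite -/q opprB.
move=> /(ler_wpM2r (sqr_ge0 (cnorm (f x)))); rewrite -mulrA.
have -> : cnorm (f x) `^ (p - 2) * cnorm (f x) ^+ 2 = cnorm (f x) `^ p.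
  by rewrite -powR_mulrn ?(ltW f0)// -powRD ?subrK// (gt_eqF f0) implybT.
apply: le_trans; rewrite mulr_suml [leRHS]big_mkcond/=; apply: ler_sum => k _.
by rewrite /low; case: ifP => //; rewrite cnorm0 expr0n mulr0.
Qed.

(** The case [M = 1], [p < 2] on a finite list, with [a] in the role of the sup norms of the [u xi].
    Both geometric constants require [p] strictly between 1 and 2. *)
Lemma paley_normalized {I : countType} (v : I -> T -> R[i]) (a phi : I -> R) (K B : R) (s : seq I) :
  (forall xi, sqint mu (v xi)) -> (forall xi, in_Linf mu (v xi)) ->
  (forall xi, 0 < a xi) -> (forall xi, 0 < phi xi) -> 0 <= K -> 0 <= B ->
  (forall xi, fine (Linf_norm mu (v xi)) <= K * a xi) ->
  (forall g, sqint mu g ->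
     \sum_(xi <- s) cnorm (FL mu v g xi) ^+ 2 <= B * \int[mu]_x (cnorm (g x) ^+ 2)) ->
  (forall t, 0 < t -> t * \sum_(xi <- s | t <= phi xi) a xi ^+ 2 <= 1) ->
  \sum_(xi <- s) cnorm (FL mu v f xi) `^ p * a xi `^ (2 - p) * phi xi `^ (2 - p) <=
   (64 * K * (2 `^ (p - 1) / (2 `^ (p - 1) - 1))
      + 16 * B * (1 - 2 `^ (- (2 - p)))^-1) * \int[mu]_x (cnorm (f x) `^ p).
Proof.
move=> vsq vI a0 phi0 K0 B0 vK bessel HM.
pose N1 y := \int[mu]_x cnorm (high y x).
pose N2 y := \int[mu]_x (cnorm (low y x) ^+ 2).
have [delta [n [d0 dP]]] :=
  dyadic_range s (fun xi => cnorm (FL mu v f xi) / (a xi * phi xi)).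
(* The high part is estimated through L^1 and the sup norm of [v xi], with the factor 2 of
   [cintegral_ae_le]; the low part is kept for Bessel's inequality. *)
have split_FL y xi : 0 < y ->
    cnorm (FL mu v f xi) <= 2 * K * a xi * N1 y + cnorm (FL mu v (low y) xi).
  move=> y0.
  have [ihigh eq] := integrable_lincomb mu (K * a xi) 0 _ _
     (integrable_high _ y0) (integrable_high _ y0).
  rewrite mul0r addr0 in eq.
  have [] := @cintegral_ae_le _ _ _ mu (fun x => high y x * conjc (v xi x)) _ _ ihigh.
  - by apply: cmeasurableM; [exact: cmeasurable_high | exact: cmeasurable_conj (vsq xi).1].
  - by move=> x; rewrite mul0r addr0 !mulr_ge0 ?cnorm_ge0// ltW.
  - have := Linf_norm_ae mu _ (vI xi); apply: filterS => x vx.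
    rewrite mul0r addr0 cnormM cnorm_conj mulrC ler_wpM2r ?cnorm_ge0//.
    exact: le_trans vx (vK xi).
  move=> hi hb; have [li _] := inner_sqint mu _ _ 1 (sqint_low _ y0) (vsq xi) ltr01.
  have -> : FL mu v f xi = FL mu v (high y) xi + FL mu v (low y) xi.
    rewrite /FL -cintegralD//; congr cintegral; apply/funext => x.
    by rewrite -mulrDl high_add_low.
  apply: (le_trans (cnormD _ _)); rewrite lerD2r; apply: (le_trans hb).
  by rewrite eq !mulrA.
have p12 : 1 < p <= 2 by rewrite p1 ltW.
have K20 : 0 <= 2 * K by rewrite mulr_ge0.
have := @weak_level_sum R I s a phi (fun xi => cnorm (FL mu v f xi)) p (2 * K) B
  N1 N2 (fun y xi => cnorm (FL mu v (low y) xi)) delta n a0 phi0 p12 K20 d0 HM.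
move=> /(_ _ _ _ _ _ dP)/le_trans; apply => //.
- by move=> y y0; apply: Rintegral_ge0 => x _; exact: cnorm_ge0.
- by move=> y xi; exact: cnorm_ge0.
- by move=> xi; exact: cnorm_ge0.
- by move=> y y0; apply: bessel; exact: sqint_low.
rewrite big_split/= -!mulr_sumr [leRHS]mulrDl; apply: lerD.
  have -> : 32 * (2 * K) = 64 * K by ring.
  by rewrite -[leRHS]mulrA ler_wpM2l ?mulr_ge0// sum_high_le.
by rewrite -[leRHS]mulrA ler_wpM2l ?mulr_ge0// sum_low_le.
Qed.

End Splitting.

(** * Paley's inequality *)

Lemma fsbig_uniq {R : realType} {I : choiceType} (s : seq I) (F : I -> R) :
  uniq s -> (\sum_(i \in [set` s]) (F i)%:E)%E = (\sum_(i <- s) F i)%:E.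
Proof. by move=> us; rewrite -fsbig_seq// sumEFin. Qed.

Lemma sum_le_esum {R : realType} {I : choiceType} (S : set I) (s : seq I) (F : I -> R) :
  uniq s -> {subset s <= S} -> ((\sum_(i <- s) F i)%:E <= \esum_(i in S) (F i)%:E)%E.
Proof.
move=> us sS; rewrite -fsbig_uniq//; apply: ereal_sup_ubound.
by exists [set` s] => //; split; [exact: finite_seq | move=> i /= /sS /set_mem].
Qed.

(** Reduces a bound on the whole sum to duplicate-free finite lists, where [dyadic_range] is
    available. *)
Lemma esum_le_sums {R : realType} {I : choiceType} (S : set I) (F : I -> R) (c : \bar R) :
  (forall s, uniq s -> {subset s <= S} -> ((\sum_(i <- s) F i)%:E <= c)%E) ->
  ((\esum_(i in S) (F i)%:E) <= c)%E.
Proof.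
move=> h; apply: ge_ereal_sup => _ [A [finA AS] <-].
rewrite fsbig_finite//= sumEFin; apply: h; first exact: fset_uniq.
by move=> i; rewrite in_fset_set// => /set_mem/AS/mem_set.
Qed.

Lemma Mphi_sum_le {d : measure_display} {T : measurableType d} {R : realType}
  (mu : {measure set T -> \bar R}) (I : countType) (u : I -> T -> R[i]) (phi : I -> R) (M t : R)
  (s : seq I) :
  Mphi mu u phi = M%:E -> uniq s -> 0 < t ->
  t * \sum_(xi <- s | t <= phi xi) fine (Linf_norm mu (u xi)) ^+ 2 <= M.
Proof.
move=> EM us t0; rewrite -lee_fin -EM.
have : (t%:E * (\esum_(xi in [set xi | (t <= phi xi)%R])
      ((fine (Linf_norm mu (u xi))) ^+ 2)%:E) <= Mphi mu u phi)%E.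
  by apply: ereal_sup_ubound; exists t.
apply: le_trans; rewrite EFinM lee_pmul2l//.
rewrite -big_filter; apply: sum_le_esum; first exact: filter_uniq.
by move=> i; rewrite mem_filter => /andP[ti _]; exact/mem_set.
Qed.

Theorem mainTheorem5 (R : realType) (d : measure_display) (T : measurableType d)
  (mu : {measure set T -> \bar R}) (I : countType) (u v : I -> T -> R[i]) (p : R)
  (mu_sf : sigma_finite setT mu)
  (u_L2 : forall xi, in_Lp mu 2 (u xi) /\ Lp_norm mu 2 (u xi) = 1%E)
  (v_L2 : forall xi, in_Lp mu 2 (v xi) /\ Lp_norm mu 2 (v xi) = 1%E)
  (biorth : forall xi eta, inner mu (u xi) (v eta) = (xi == eta)%:R)
  (u_riesz : riesz_basis mu u)
  (u_Linf : forall xi, in_Linf mu (u xi))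
  (v_Linf : forall xi, in_Linf mu (v xi))
  (hp : 1 < p <= 2)
  (hratio : exists K : R, forall xi,
     fine (Linf_norm mu (v xi)) / fine (Linf_norm mu (u xi)) <= K) :
  exists C : R, 0 < C /\
    forall (phi : I -> R) (M : R),
      (forall xi, 0 < phi xi) ->
      Mphi mu u phi = M%:E ->
      forall f : T -> R[i], in_Lp mu p f ->
        ((\esum_(xi in [set: I])
            ((cnorm (FL mu v f xi)) `^ p
             * (fine (Linf_norm mu (u xi))) `^ (2 - p)
             * (phi xi) `^ (2 - p))%:E) `^ p^-1
         <= (C * M `^ ((2 - p) / p))%:E * Lp_norm mu p f)%E.
Proof.
have /andP[p1 p2] := hp; have p0 : 0 < p := lt_trans ltr01 p1.
have [B B0 bessel] := riesz_bessel mu I u v u_riesz v_L2 biorth.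
set a := fun xi => fine (Linf_norm mu (u xi)).
have a0 xi : 0 < a xi.
  by apply: Linf_norm_gt0; [exact: u_Linf | exact: (u_L2 xi).1 | exact: (u_L2 xi).2].
have vsq xi : sqint mu (v xi) by have [] := in_L2_sqint mu _ (v_L2 xi).1.
have [K K0 vK] : exists2 K, 0 < K & forall xi, fine (Linf_norm mu (v xi)) <= K * a xi.
  (* The maximum with 1 makes the constant positive. *)
  have [K hK] := hratio; exists (Num.max K 1) => [|xi]; first by rewrite lt_max ltr01 orbT.
  by rewrite -ler_pdivrMr// le_max hK.
have [C C0 paley] : exists2 C, 0 < C & forall (phi : I -> R) (s : seq I) f,
    (forall xi, 0 < phi xi) -> uniq s ->
    (forall t, 0 < t -> t * \sum_(xi <- s | t <= phi xi) a xi ^+ 2 <= 1) ->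
    in_Lp mu p f ->
    \sum_(xi <- s) cnorm (FL mu v f xi) `^ p * a xi `^ (2 - p) * phi xi `^ (2 - p) <=
      C * \int[mu]_x (cnorm (f x) `^ p).
  (* At [p = 2] the constant of [dyadic_sum_above] degenerates, but all weights have exponent 0 and
     Bessel's inequality is the claim. *)
  move: p2; rewrite le_eqVlt => /predU1P[pE|p2].
    exists B => // phi s f phi0 us _; rewrite pE => /(in_L2_sqint mu)[fsq _].
    under eq_bigr do rewrite subrr !powRr0 !mulr1 powR_mulrn ?cnorm_ge0//.
    apply: (le_trans (bessel _ fsq _ us)).
    rewrite ler_pM2l//; under [leRHS]eq_Rintegral do rewrite powR_mulrn ?cnorm_ge0//.
    exact: lexx.
  exists (64 * K * (2 `^ (p - 1) / (2 `^ (p - 1) - 1))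
      + 16 * B * (1 - 2 `^ (- (2 - p)))^-1).
    have q1 : 1 < 2 `^ (p - 1) :> R by rewrite powR2_gt1// subr_gt0.
    have q2 : 2 `^ (- (2 - p)) < 1 :> R by rewrite powRN invf_lt1 ?powR_gt0// powR2_gt1// subr_gt0.
    by apply: addr_gt0; rewrite !mulr_gt0// ?invr_gt0 ?subr_gt0// (lt_trans ltr01).
  move=> phi s f phi0 us HM fp.
  apply: paley_normalized => //.
  - exact: fp.1.
  - by have [] := in_Lp_integrable mu _ _ p0 fp.
  - exact: ltW.
  - exact: ltW.
  - by move=> g gsq; exact: bessel.
exists (C `^ p^-1); split; first exact: powR_gt0.
move=> phi M phi0 EM f fp.
have [ifp ->] := in_Lp_integrable mu _ _ p0 fp.
set J := \int[mu]_x _.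
have J0 : 0 <= J by apply: Rintegral_ge0 => x _; exact: powR_ge0.
have sumle s : uniq s ->
    \sum_(xi <- s) cnorm (FL mu v f xi) `^ p * a xi `^ (2 - p) * phi xi `^ (2 - p) <=
    C * M `^ (2 - p) * J.
  (* The empty list is treated apart because [M] can vanish when there is no index; any index [xi0]
     forces [M > 0], by taking [t = phi xi0] in the supremum. *)
  case: s => [|xi0 s us]; first by rewrite big_nil !mulr_ge0 ?powR_ge0// ltW.
  have M0 : 0 < M.
    have := Mphi_sum_le mu I u phi M (phi xi0) [:: xi0] EM isT (phi0 xi0).
    rewrite big_cons big_nil lexx addr0; apply: lt_le_trans.
    by rewrite mulr_gt0// exprn_gt0//; exact: a0.
  have := paley (fun xi => phi xi / M) (xi0 :: s) f.
  have -> : \sum_(xi <- xi0 :: s)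
        cnorm (FL mu v f xi) `^ p * a xi `^ (2 - p) * (phi xi / M) `^ (2 - p) =
      (\sum_(xi <- xi0 :: s)
        cnorm (FL mu v f xi) `^ p * a xi `^ (2 - p) * phi xi `^ (2 - p)) / M `^ (2 - p).
    rewrite mulr_suml; apply: eq_bigr => xi _.
    rewrite powRM ?(ltW (phi0 _)) ?invr_ge0 ?(ltW M0)// mulrA; congr (_ * _).
    by rewrite -powR_inv1 ?(ltW M0)// -powRrM mulN1r powRN.
  rewrite ler_pdivrMr ?powR_gt0// mulrAC; apply => //.
  - by move=> xi; rewrite divr_gt0.
  - move=> t t0; under eq_bigl do rewrite ler_pdivlMr//.
    (* Level [t] for [phi xi / M] is level [t * M] for [phi]; cancelling [M] gives the normalised
       hypothesis. *)
    have := Mphi_sum_le mu I u phi M (t * M) (xi0 :: s) EM us (mulr_gt0 t0 M0).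
    by rewrite mulrAC ger_pMl.
have le : ((\esum_(xi in [set: I])
            ((cnorm (FL mu v f xi)) `^ p * a xi `^ (2 - p) * (phi xi) `^ (2 - p))%:E)
      <= (C * M `^ (2 - p) * J)%:E)%E.
  by apply: esum_le_sums => s us _; rewrite lee_fin sumle.
have pV0 : 0 <= p^-1 by rewrite invr_ge0 ltW.
apply: (le_trans (gt0_ler_poweR pV0 _ _ le)).
- rewrite in_itv/= leey andbT; apply: esum_ge0 => xi _.
  by rewrite lee_fin !mulr_ge0 ?powR_ge0.
- by rewrite in_itv/= leey andbT lee_fin !mulr_ge0 ?powR_ge0// ltW.
rewrite poweR_EFin -EFinM lee_fin !powRM ?mulr_ge0 ?powR_ge0 ?(ltW C0)//.
by rewrite -powRrM.
Qed.
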